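(* For any integer $k\ge2$, the sequence $(k^n)_{n\ge1}$ is ultimately bad in $L^1$.
   Context: For a function $f$ on a measure space $(X,\mu)$, $\|f\|_{1,\infty}=\sup_{y>0}y\cdot\mu\{x:|f(x)|\ge y\}$. For a sequence $w=(w_t)_{t\in\mathbb N}$ of positive reals, $C_1(w)=\sup_{y>0}\sum_t[y<w_t<2^ty]\,w_t$, where $[P]$ is $1$ if $P$ holds and $0$ otherwise. A sequence $(a_n)$ of real numbers (respectively integers) is called ultimately bad in $L^1$ if for any aperiodic measure-preserving flow $(T^t)_{t\in\mathbb R}$ (respectively any aperiodic measure-preserving transformation $T$) of a probability space and every sequence $(w_t)$ of positive reals with $C_1(w)=\infty$, there is no constant $C>0$ such that $\big\|\sup_tw_t2^{-t}\sum_{n\le2^t}f(T^{a_n}x)\big\|_{1,\infty}\le C\|f\|_1$ for all $f\in L^1$. A transformation $T$ is aperiodic if $\mu\{x:T^nx=x\text{ for some }n\ge1\}=0$; a flow is aperiodic if $\mu\{x:T^tx=x\text{ for some }t\ne0\}=0$.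
   Formalization: The probability space is assumed to have countably many measurable sets separating points off a null set (true of standard and Lebesgue spaces); otherwise the claim fails, e.g. for the shift on the integers with trivial sigma-algebra and w = 1. *)

(* Defs.v *)
From mathcomp Require Import all_boot all_order all_algebra.
From mathcomp Require Import all_classical all_reals all_analysis.

Set Implicit Arguments.
Unset Strict Implicit.
Unset Printing Implicit Defensive.
Import Order.TTheory GRing.Theory Num.Theory.
Import numFieldNormedType.Exports.
Local Open Scope classical_set_scope.
Local Open Scope ring_scope.

(* [g] is extended-real valued because it will be a supremum over all scales,
   which may be infinite at some points. *)
Definition weak_L1_norm d (X : measurableType d) (R : realType)
    (mu : set X -> \bar R) (g : X -> \bar R) : \bar R :=
  ereal_sup [set (y%:E * mu [set x | y%:E <= `|g x|])%E
            | y in [set y : R | 0 < y]].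

Definition C1 (R : realType) (w : nat -> R) : \bar R :=
  ereal_sup [set (\sum_(0 <= t <oo)
                    (if (y < w t < 2 ^+ t * y)%R then w t else 0%R)%:E)%E
            | y in [set y : R | 0 < y]].

(* [S n] stands for T^{a_n}; the index n = 0 is never used. *)
Definition weighted_maximal (X : Type) (R : realType) (w : nat -> R)
    (S : nat -> X -> X) (f : X -> R) (x : X) : \bar R :=
  ereal_sup (range (fun t : nat =>
    (w t * 2 ^- t * \sum_(1 <= n < (2 ^ t).+1%N) f (S n x))%:E)).

Definition weak_type_bound d (X : measurableType d) (R : realType)
    (mu : {measure set X -> \bar R}) (w : nat -> R) (S : nat -> X -> X)
    (C : R) : Prop :=
  forall f : X -> R, f \in Lfun mu 1%E ->
    (weak_L1_norm mu (weighted_maximal w S f)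
       <= C%:E * 'N[mu]_1[EFin \o f])%E.

Definition bad_along d (X : measurableType d) (R : realType)
    (mu : {measure set X -> \bar R}) (S : nat -> X -> X) : Prop :=
  forall w : nat -> R, (forall t, 0 < w t) -> C1 w = +oo%E ->
    ~ exists C : R, 0 < C /\ weak_type_bound mu w S C.

Definition measure_preserving d (X : measurableType d) (R : realType)
    (mu : {measure set X -> \bar R}) (T : X -> X) : Prop :=
  measurable_fun setT T /\
  forall A : set X, measurable A -> mu (T @^-1` A) = mu A.

(* Some regularity of the probability space is implicit in a pointwise notion
   of aperiodicity: for the trivial sigma-algebra, a map without periodic
   points is aperiodic, but every measurable function is constant and the
   maximal inequality holds whenever w is bounded.  The condition below is
   satisfied by all standard Borel probability spaces, by their completions
   and by all Lebesgue (Rokhlin) spaces. *)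
Definition countably_separated d (X : measurableType d) (R : realType)
    (mu : {measure set X -> \bar R}) : Prop :=
  exists (A : nat -> set X) (N : set X),
    [/\ forall i, measurable (A i), mu.-negligible N &
        forall x y, ~ N x -> ~ N y -> (forall i, A i x <-> A i y) -> x = y].

(* "mu E = 0" is read as "E is contained in a measurable null set", since the
   set of periodic points need not belong to the sigma-algebra. *)
Definition aperiodic d (X : measurableType d) (R : realType)
    (mu : {measure set X -> \bar R}) (T : X -> X) : Prop :=
  mu.-negligible [set x | exists n : nat, (1 <= n)%N /\ iter n T x = x].

Definition aperiodic_flow d (X : measurableType d) (R : realType)
    (mu : {measure set X -> \bar R}) (T : R -> X -> X) : Prop :=
  mu.-negligible [set x | exists t : R, t != 0 /\ T t x = x].

(* No joint measurability in (t, x) is assumed. *)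
Definition measure_preserving_flow d (X : measurableType d) (R : realType)
    (mu : {measure set X -> \bar R}) (T : R -> X -> X) : Prop :=
  [/\ forall t, measure_preserving mu (T t),
      T 0 = id &
      forall s t, T (s + t) = T s \o T t].

(* A genuine inverse only when T is bijective. *)
Definition inverse_map (X : choiceType) (T : X -> X) (y : X) : X :=
  xget y [set x | T x = y].

Definition int_iter (X : choiceType) (T : X -> X) (m : int) : X -> X :=
  match m with
  | Posz n => iter n T
  | Negz n => iter n.+1 (inverse_map T)
  end.

Definition invertible d (X : measurableType d) (T : X -> X) : Prop :=
  bijective T /\ measurable_fun setT (inverse_map T).

(* Transformations are not assumed to be invertible, unless a negative power
   of T occurs in the averages. *)
Definition ultimately_bad_int (R : realType) (a : nat -> int) : Prop :=
  forall (d : measure_display) (X : measurableType d) (mu : probability X R)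
         (T : X -> X),
    countably_separated mu ->
    measure_preserving mu T ->
    ((exists n : nat, (1 <= n)%N /\ a n < 0) -> invertible T) ->
    aperiodic mu T ->
    bad_along mu (fun n => int_iter T (a n)).

Definition ultimately_bad_real (R : realType) (a : nat -> R) : Prop :=
  forall (d : measure_display) (X : measurableType d) (mu : probability X R)
         (T : R -> X -> X),
    countably_separated mu ->
    measure_preserving_flow mu T ->
    aperiodic_flow mu T ->
    bad_along mu (fun n => T (a n)).

(* Main.v *)
Require Import Defs.
From mathcomp Require Import all_boot all_order all_algebra.
From mathcomp Require Import all_classical all_reals all_analysis.
From mathcomp Require Import measurable_realfun.
From mathcomp Require Import ring lra zify.
Set Implicit Arguments.
Unset Strict Implicit.
Unset Printing Implicit Defensive.
Import Order.TTheory GRing.Theory Num.Theory.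
Local Open Scope ring_scope.

(** The weak type inequality is tested on functions that live on a tower over
    a small set and read off base-k digits of the level.

    Since T is aperiodic and the space is countably separated, for every N
    there is a measurable set A of positive measure whose preimages under
    T^0, ..., T^(N-1) are disjoint ([aperiodic_tower_base]).  Its measure may be
    tiny: both sides of the inequality are multiples of it when f is constant
    on the levels, so the weak type bound turns into a counting inequality on
    {0, ..., N-1}, where T^(k^n) moves a level i down to i - k^n
    ([tower_transference]).

    Take N = k^M and write the levels with M digits in base k.  When the n-th
    digit is nonzero, subtracting k^n just decrements it.  Let B_1, ..., B_J be
    disjoint blocks of exponents.  Give block i a weight wt i in the cyclic
    group of order J + 1, distinct blocks having distinct weights, and let h be
    the sum over i of wt i times the sum of the digits in B_i.  Subtracting k^n
    with n in B_i lowers h by wt i, whatever n in B_i is chosen.  So if f is the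
    indicator of the level set h = v, then a level with h = v + wt i is sent
    into the support of f by every T^(k^n) such that n is in B_i and the n-th
    digit is nonzero.  This is at least half of B_i for at least half of the
    levels, and the sets h = v + wt i are disjoint for distinct i.  Hence, on
    average over v, the maximal function is large on a set about J/2 times
    bigger than the support of f, each block contributing as if the blocks were
    independent ([level_sets_of_block_sum], [card_blocks_le]).

    It remains to use many blocks.  Fix y.  For each scale t with
    y < w_t < 2^t y, cut the exponents in (2^(t-1), 2^t] into blocks of length
    about 2^t y / (4 w_t), the number of hits for which
    w_t 2^(-t) times this number is comparable to y.  There are at least
    w_t / (5 y) such blocks ([block_size_and_number]), so the total number of
    blocks over all scales is comparable to the sum defining C_1(w) at y,
    divided by y.  A weak type bound therefore bounds C_1(w)
    ([partial_C1_le]).  The flow reduces to its time-one map. *)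

(** * Digit vectors and level sets of weighted digit sums *)

(** One definition serves twice: with g n = k^n it is the integer whose digits
    are c, and with group-valued weights it is the digit sum whose level sets
    carry the test functions. *)
Definition wsum (V : nmodType) (k M : nat) (g : 'I_M -> V)
    (c : {ffun 'I_M -> 'I_k}) : V :=
  \sum_n g n *+ c n.
Arguments wsum {V k M}.

(** At a zero digit [ord_pred] wraps around to k - 1, so this is subtraction
    of k^n only where the n-th digit is nonzero. *)
Definition decr (k M : nat) (n : 'I_M) (c : {ffun 'I_M -> 'I_k}) :
    {ffun 'I_M -> 'I_k} :=
  [ffun m => if m == n then ord_pred (c m) else c m].
Arguments decr {k M}.

Lemma wsum_decr (V : nmodType) (k M : nat) (g : 'I_M -> V)
    (c : {ffun 'I_M -> 'I_k}) (n : 'I_M) :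
  (0 < c n)%N -> wsum g c = wsum g (decr n c) + g n.
Proof.
move=> cn0; rewrite /wsum (bigD1 n)//= [in RHS](bigD1 n)//=.
rewrite (eq_bigr (fun m => g m *+ decr n c m)); last first.
  by move=> m /negPf mn; rewrite ffunE mn.
rewrite addrAC; congr (_ + _); rewrite ffunE eqxx /=.
rewrite -subn1 -addnBAC// modnDr modn_small; last first.
  by rewrite (leq_ltn_trans (leq_subr _ _)).
by rewrite -mulrSr subn1 prednK.
Qed.

Definition digits_value (k M : nat) : {ffun 'I_M -> 'I_k} -> nat :=
  wsum (fun n : 'I_M => (k ^ n)%N).
Arguments digits_value {k M}.

Lemma digits_valueE (k M : nat) (c : {ffun 'I_M -> 'I_k}) :
  digits_value c = (\sum_n c n * k ^ n)%N.
Proof.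
apply: eq_bigr => n _; elim: (nat_of_ord (c n)) => [|m IH]; first by rewrite mulr0n mul0n.
by rewrite mulrS IH mulSn.
Qed.

Lemma digits_value_lt (k M : nat) (c : {ffun 'I_M -> 'I_k}) :
  (digits_value c < k ^ M)%N.
Proof.
rewrite digits_valueE.
elim: M c => [|M IH] c; first by rewrite big_ord0 expn0.
rewrite big_ord_recr/=.
have := IH [ffun n => c (widen_ord (leqnSn M) n)].
under eq_bigr do rewrite ffunE.
set s := (\sum_(_ < _) _)%N; have := ltn_ord (c ord_max).
rewrite expnS; move: (k ^ M)%N => K; nia.
Qed.

Lemma digits_value_inj (k M : nat) : injective (@digits_value k M).
Proof.
move=> c c'; rewrite !digits_valueE.
elim: M c c' => [|M IH] c c'; first by move=> _; apply/ffunP => -[].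
rewrite !big_ord_recl/= !expn0 !muln1.
have E (b : {ffun 'I_M.+1 -> 'I_k}) : (\sum_(i < M) b (lift ord0 i) * k ^ bump 0 i =
    k * \sum_(i < M) [ffun n => b (lift ord0 n)] i * k ^ i)%N.
  by rewrite big_distrr/=; apply: eq_bigr => i _; rewrite ffunE /bump/= add1n expnS mulnCA.
rewrite !E => eqv.
have k0 : (0 < k)%N by case: k c {c' IH E eqv} => // c; case: (c ord0).
have c0 : c ord0 = c' ord0.
  have := congr1 (modn^~ k) eqv.
  by rewrite ![(k * _)%N]mulnC ![(_ + _ * k)%N]addnC !modnMDl !modn_small// => /val_inj.
move: eqv; rewrite c0 => /addnI/eqP; rewrite eqn_pmul2l// => /eqP /IH eqc.
apply/ffunP => i; case: (unliftP ord0 i) => [j ->|-> //].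
by have /ffunP/(_ j) := eqc; rewrite !ffunE.
Qed.

Definition half_nonzero (k M : nat) (A : {set 'I_M}) :
    {set {ffun 'I_M -> 'I_k}} :=
  [set c : {ffun 'I_M -> 'I_k} | #|A| <= 2 * #|[set n in A | 0 < c n]|]%N.
Arguments half_nonzero {k M}.

(** Replacing every digit c by k - 1 - c makes the zero digits nonzero, so of a
    vector and its reversal at least one has half of its digits in A
    nonzero. *)
Lemma card_half_nonzero (k M : nat) (A : {set 'I_M}) :
  (1 < k)%N -> (#|{ffun 'I_M -> 'I_k}| <= 2 * #|@half_nonzero k M A|)%N.
Proof.
move=> k1; set Y := half_nonzero A.
pose f (c : {ffun 'I_M -> 'I_k}) : {ffun 'I_M -> 'I_k} := [ffun n => rev_ord (c n)].
have finj : injective f.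
  move=> c c' /ffunP ff; apply/ffunP => n; have := ff n.
  by rewrite !ffunE => /rev_ord_inj.
have sub : ~: Y \subset f @^-1: Y.
  apply/fintype.subsetP => c; rewrite !inE -ltnNge => cY.
  have cardA : #|A| =
      (#|[set n in A | (0 < c n)%N]| + #|[set n in A | ~~ (0 < c n)%N]|)%N.
    rewrite -(cardsID [set n | (0 < c n)%N] A).
    by congr (_ + _)%N; apply: eq_card => n; rewrite !inE // andbC.
  have zeros : (#|[set n in A | ~~ (0 < c n)]| <= #|[set n in A | (0 < f c n)]|)%N.
    apply/subset_leq_card/fintype.subsetP => n; rewrite !inE ffunE => /andP[->]/=.
    by rewrite -leqNgt leqn0 => /eqP cn0 /=; rewrite cn0 subn_gt0.
  rewrite cardA in cY *; move: zeros cY.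
  move: #|[set n in A | (0 < c n)%N]| #|[set n in A | ~~ (0 < c n)%N]|.
  move: #|[set n in A | (0 < f c n)%N]| => x y z.
  by lia.
rewrite -(cardsC Y) mul2n -addnn leq_add2l.
by apply: leq_trans (subset_leq_card sub) _; rewrite card_preimset.
Qed.

(** E v is the level set h = v of the weighted digit sum and X v consists of
    the vectors that some block moves into E v: the part of h = v + wt i, over
    all i, where at least half of the digits in B i are nonzero.  No single v
    needs to be good: the inequality between the sizes of E v and X v is to be
    summed over v, and a vector c with half of the digits in B i nonzero
    belongs to X v for exactly one v for each such i. *)
Lemma level_sets_of_block_sum (k M : nat) (I : finType) (B : I -> {set 'I_M}) :
  (1 < k)%N ->
  (forall i j n, n \in B i -> n \in B j -> i = j) ->
  exists (V : finType) (E X : V -> {set {ffun 'I_M -> 'I_k}}),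
    [/\ (\sum_v #|E v| = #|{ffun 'I_M -> 'I_k}|)%N,
        (#|I| * #|{ffun 'I_M -> 'I_k}| <= 2 * \sum_v #|X v|)%N &
        forall v c, c \in X v -> exists i,
          (#|B i| <= 2 * #|[set n in B i | (0 < c n)%N && (decr n c \in E v)]|)%N].
Proof.
move=> k1 disjB.
pose V : finZmodType := 'I_(#|I|).+1.
pose wt (i : I) : V := inord (enum_rank i) : 'I_(#|I|).+1.
have wt_inj : injective wt.
  move=> i j /(congr1 val); rewrite /= !inordK ?ltnS ?(ltnW (ltn_ord _))//.
  by move=> /val_inj/enum_rank_inj.
pose g n := \sum_(i | n \in B i) wt i.
have gE i n : n \in B i -> g n = wt i.
  move=> nB; rewrite /g (big_pred1 i)// => j /=; apply/idP/eqP => [nj|->//].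
  exact: disjB nj nB.
pose h := @wsum V k M g.
pose Y i : {set {ffun 'I_M -> 'I_k}} := half_nonzero (B i).
pose X (v : V) := [set c | [exists i, (c \in Y i) && (h c == v + wt i)]].
exists (V : finType), (fun v => [set c | h c == v]), X; split.
- rewrite -[RHS]sum1_card (partition_big h xpredT)//=.
  by apply: eq_bigr => v _; rewrite -sum1_card; apply: eq_bigl => c; rewrite inE.
- under eq_bigr => v _ do rewrite -sum1_card big_mkcond/=.
  rewrite exchange_big/=.
  under eq_bigr => c _.
    rewrite -big_mkcond sum1_card.
    (* Double counting: for fixed c, v is determined by i as h c - wt i. *)
    rewrite (_ : #|_| = #|(fun i => h c - wt i) @: [set i | c \in Y i]|); last first.
      apply: eq_card => v; transitivity (c \in X v) => //.
      rewrite inE; apply/existsP/imsetP => -[i].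
        by case/andP=> cY /eqP hc; exists i; [rewrite inE|rewrite hc addrK].
      by rewrite inE => cY ->; exists i; rewrite cY subrK eqxx.
    rewrite card_imset; last by move=> i j /addrI/oppr_inj/wt_inj.
    rewrite -sum1_card big_mkcond/=.
  over.
  rewrite exchange_big/= big_distrr/= -sum_nat_const.
  apply: leq_sum => i _; rewrite -big_mkcond/=.
  rewrite (eq_bigl (fun c => c \in Y i)); last by move=> c; rewrite inE.
  by rewrite sum1_card; apply: card_half_nonzero.
- move=> v c; rewrite inE => /existsP[i /andP[]]; rewrite inE => cY /eqP hc.
  exists i; apply: leq_trans cY _; rewrite leq_mul2l/=.
  apply/subset_leq_card/fintype.subsetP => n.
  rewrite !inE => /andP[nB cn]; rewrite nB cn/=.
  by apply/eqP/(addIr (wt i)); rewrite -hc -(gE _ _ nB) /h -wsum_decr.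
Qed.

(** * Aperiodic towers *)

Local Open Scope classical_set_scope.

Lemma measure_preserving_iter d (X : measurableType d) (R : realType)
    (mu : {measure set X -> \bar R}) (T : X -> X) (n : nat) :
  measure_preserving mu T -> measure_preserving mu (iter n T).
Proof.
move=> [mT muT]; elim: n => [|n [mTn muTn]].
  by split => // A mA; exact: measurable_id.
split; first exact: (measurableT_comp mT mTn).
move=> A mA; rewrite -(muT A mA) -(muTn (T @^-1` A))//.
by rewrite -[X in measurable X]setTI; exact: mT.
Qed.

Lemma measurable_preimage_mp d (X : measurableType d) (R : realType)
    (mu : {measure set X -> \bar R}) (T : X -> X) (A : set X) :
  measure_preserving mu T -> measurable A -> measurable (T @^-1` A).
Proof. by move=> [mT _] mA; rewrite -[X in measurable X]setTI; exact: mT. Qed.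

Lemma negligible_preimage d (X : measurableType d) (R : realType)
    (mu : {measure set X -> \bar R}) (T : X -> X) (N : set X) :
  measure_preserving mu T -> mu.-negligible N -> mu.-negligible (T @^-1` N).
Proof.
move=> mpT [A [mA A0 NA]]; exists (T @^-1` A); split.
- exact: measurable_preimage_mp mpT mA.
- by rewrite (mpT.2 _ mA).
- by move=> x /=; exact: NA.
Qed.

(** A point moved by S is separated from its image by some set P i of the
    separating family.  If A met none of the countably many sets where P i or
    its complement separates x from S x in positive measure, then almost every
    point of A would be fixed. *)
Lemma displaced_subset d (X : measurableType d) (R : realType)
    (mu : {measure set X -> \bar R}) (S : X -> X) (A : set X) :
  countably_separated mu -> measure_preserving mu S ->
  mu.-negligible [set x | S x = x] -> measurable A -> (0 < mu A)%E ->
  exists B, [/\ measurable B, B `<=` A, (0 < mu B)%E & B `&` S @^-1` B = set0].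
Proof.
move=> [P [N [mP negN sepN]]] mpS negS mA A0.
(* F i and G i are disjoint from their preimages under S. *)
pose F i := A `&` (P i `&` S @^-1` (~` P i)).
pose G i := A `&` (~` P i `&` S @^-1` (P i)).
have mF i : measurable (F i).
  apply: measurableI => //; apply: measurableI => //.
  by apply: measurable_preimage_mp mpS _; exact: measurableC.
have mG i : measurable (G i).
  apply: measurableI => //; apply: measurableI; first exact: measurableC.
  exact: measurable_preimage_mp mpS _.
have [[i Fi]|F0] := pselect (exists i, (0 < mu (F i))%E).
  exists (F i); split => //; first by move=> x [].
  by rewrite -subset0 => x [[_ [_ nP]] [_ [/nP]]].
have [[i Gi]|G0] := pselect (exists i, (0 < mu (G i))%E).
  exists (G i); split => //; first by move=> x [].
  by rewrite -subset0 => x [[_ [_ SP]] [_ [/(_ SP)]]].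
suff /(measure_negligible mA) A00 : mu.-negligible A by rewrite A00 ltxx in A0.
have null B : measurable B -> ~ (0 < mu B)%E -> mu.-negligible B.
  by move=> mB /negP; rewrite -leNgt measure_le0 => /eqP /negligibleP; exact.
apply: (@negligibleS _ _ _ _ (((N `|` S @^-1` N) `|` [set x | S x = x])
    `|` (\bigcup_i F i `|` \bigcup_i G i))); last first.
  apply: negligibleU; apply: negligibleU.
  - apply: negligibleU => //; exact: negligible_preimage.
  - exact: negS.
  - by apply: negligible_bigcup => i; apply: null => // Fi; apply: F0; exists i.
  - by apply: negligible_bigcup => i; apply: null => // Gi; apply: G0; exists i.
move=> x Ax; apply: contrapT => /not_orP[/not_orP[/not_orP[nN nSN] nfix] /not_orP[nF nG]].
apply: nfix => /=; apply: sepN => // i; split => Pi; apply: contrapT => nPi.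
  by apply: nG; exists i.
by apply: nF; exists i.
Qed.

(** Disjointness of B from its preimage under T^e passes to subsets of B, so
    the times e = 1, ..., N - 1 can be treated one after the other. *)
Lemma aperiodic_tower_base d (X : measurableType d) (R : realType)
    (mu : probability X R) (T : X -> X) (N : nat) :
  countably_separated mu -> measure_preserving mu T -> aperiodic mu T ->
  exists B, [/\ measurable B, (0 < mu B)%E &
    forall i j, (i < j < N)%N -> iter i T @^-1` B `&` iter j T @^-1` B = set0].
Proof.
move=> sep mpT apT.
suff [B [mB B0 disjB]] : exists B, [/\ measurable B, (0 < mu B)%E &
    forall e, (0 < e < N)%N -> B `&` iter e T @^-1` B = set0].
  exists B; split => // i j /andP[ij jN]; rewrite -subset0 => x [/= Bi Bj].
  have : (B `&` iter (j - i) T @^-1` B) (iter i T x).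
    by split => //=; rewrite -iterD subnK// ltnW.
  by rewrite disjB// subn_gt0 ij (leq_ltn_trans (leq_subr _ _)).
elim: N => [|N [B [mB B0 disjB]]].
  by exists setT; split; rewrite ?probability_setT// => e; rewrite andbF.
have [->|N0] := posnP N; first by exists B; split => // -[|[]].
have negN : mu.-negligible [set x | iter N T x = x].
  by apply: negligibleS apT => x TNx; exists N.
have [B' [mB' B'B B'0 disjB']] :=
  displaced_subset sep (measure_preserving_iter N mpT) negN mB B0.
exists B'; split => // e /andP[e0]; rewrite ltnS leq_eqVlt => /predU1P[->//|eN].
rewrite -subset0 => x [/B'B Bx /B'B Bex].
by rewrite -(disjB e)// e0.
Qed.

(** * From the weak type inequality to counting digit vectors *)

Lemma measurable_weighted_maximal d (X : measurableType d) (R : realType)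
    (w : nat -> R) (S : nat -> X -> X) (f : X -> R) :
  (forall n, measurable_fun setT (S n)) -> measurable_fun setT f ->
  measurable_fun setT (weighted_maximal w S f : X -> \bar R).
Proof.
move=> mS mf; pose h (t : nat) (x : X) : \bar R :=
  (w t * 2 ^- t * \sum_(1 <= n < (2 ^ t).+1%N) f (S n x))%:E.
have mh t : measurable_fun setT (h t).
  apply/measurable_EFinP; apply: measurable_funM => //.
  by apply: measurable_sum => n; exact: (measurableT_comp mf (mS n)).
have -> : weighted_maximal w S f = (fun x => esups (h ^~ x) 0%N).
  apply/funext => x; rewrite /weighted_maximal /esups /=; congr ereal_sup.
  by rewrite /sdrop; congr image; apply/seteqP; split => // t _ /=.
exact: measurable_fun_esups.
Qed.

Lemma measure_disjoint_union d (X : measurableType d) (R : realType)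
    (mu : {measure set X -> \bar R}) (J : finType) (P : J -> set X)
    (Z : {set J}) (b : R) :
  (forall c, measurable (P c)) -> (forall c, mu (P c) = b%:E) ->
  (forall c c' x, P c x -> P c' x -> c = c') ->
  mu (\bigcup_(c in [set` enum Z]) P c) = (#|Z|%:R * b)%:E.
Proof.
move=> mP muP disjP; rewrite measure_fin_bigcup//; last first.
  by move=> c c' _ _ [x [Pc Pc']]; exact: disjP Pc Pc'.
rewrite -fsbig_seq ?enum_uniq// big_enum/=.
rewrite (eq_bigr (fun=> b%:E)) => [|c _]; last exact: muP.
by rewrite sumEFin sumr_const mulr_natl.
Qed.

Lemma card_le_sum_nat (R : realType) (M N : nat) (A : {set 'I_M}) (F : nat -> R) :
  (forall n, 0 <= F n) ->
  (forall n, n \in A -> (0 < n <= N)%N /\ 1 <= F n) ->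
  #|A|%:R <= \sum_(1 <= n < N.+1) F n.
Proof.
move=> F0 AF; pose s := [seq val n | n <- enum A].
have us : uniq s by rewrite map_inj_uniq ?enum_uniq//; exact: val_inj.
rewrite (bigID (mem s))/= -[leLHS]addr0 lerD//; last exact: sumr_ge0.
rewrite -big_filter (perm_big s); last first.
  apply: uniq_perm => //; first by rewrite filter_uniq// iota_uniq.
  move=> n; rewrite mem_filter mem_index_iota; apply: andb_idr => /mapP[m].
  by rewrite mem_enum => /AF[+ _] ->.
rewrite big_map big_enum/= -sum1_card natr_sum; apply: ler_sum => n /AF[_].
exact.
Qed.

(** Tests the inequality on the sum f of the indicators of the levels of the
    tower indexed by E.  If the n-th digit of c is nonzero, T^(k^n) maps level
    c into level c - k^n.  So the hypothesis on Z makes the maximal function of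
    f at least y on every level indexed by Z; the measure of the base cancels
    in the end. *)
Lemma tower_transference d (X : measurableType d) (R : realType)
    (mu : probability X R) (T : X -> X) (k M : nat) (w : nat -> R) (C y : R)
    (B : set X) (E Z : {set {ffun 'I_M -> 'I_k}}) :
  measure_preserving mu T ->
  weak_type_bound mu w (fun n => iter (k ^ n) T) C ->
  (forall t, 0 < w t) ->
  measurable B -> (0 < mu B)%E ->
  (forall i j, (i < j < k ^ M)%N ->
    iter i T @^-1` B `&` iter j T @^-1` B = set0) ->
  0 < y ->
  (forall c, c \in Z -> exists t, exists A : {set 'I_M},
     (forall n, n \in A -> [/\ (0 < n <= 2 ^ t)%N, (0 < c n)%N & decr n c \in E]) /\
     y * 2 ^+ t <= w t * #|A|%:R) ->
  y * #|Z|%:R <= C * #|E|%:R.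
Proof.
move=> mpT weak w0 mB B0 disjB y0 ZE.
pose P (c : {ffun 'I_M -> 'I_k}) := iter (digits_value c) T @^-1` B.
have mpTn n := measure_preserving_iter n mpT.
have mP c : measurable (P c) by exact: (measurable_preimage_mp (mpTn _)).
have [b muB] : exists b, mu B = b%:E.
  by exists (fine (mu B)); rewrite fineK// fin_num_measure.
have b0 : 0 < b by rewrite muB lte_fin in B0.
have muP c : mu (P c) = b%:E by rewrite (mpTn _).2.
have disjP c c' x : P c x -> P c' x -> c = c'.
  move=> Pc Pc'; apply: digits_value_inj.
  case: (ltngtP (digits_value c) (digits_value c')) => // lt_cc'.
    have := disjB _ _ (introT andP (conj lt_cc' (digits_value_lt c'))).
    by move/seteqP => [/(_ x)]; case.
  have := disjB _ _ (introT andP (conj lt_cc' (digits_value_lt c))).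
  by move/seteqP => [/(_ x)]; case.
pose f (x : X) : R := \sum_(c <- enum E) \1_(P c) x.
have f0 x : 0 <= f x by apply: sumr_ge0 => c _; rewrite indicE.
have mf : measurable_fun setT f.
  by apply: measurable_sum => c; exact: measurable_indic.
have intf : f \in Lfun mu 1%E.
  apply/Lfun1_integrable.
  rewrite (_ : _ \o _ = fun x => (\sum_(c <- enum E) (\1_(P c) x)%:E)%E); last first.
    by apply/funext => x /=; rewrite sumEFin.
  by apply: (integrable_sum (measurableT : measurable [set: X])) => c _; apply: integrable_indic.
have normf : ('N[mu]_1[EFin \o f] = (#|E|%:R * b)%:E)%E.
  rewrite Lnorm1.
  under eq_integral => x _ do rewrite /= ger0_norm// -sumEFin.
  rewrite ge0_integral_sum//; last by move=> c; apply/measurable_EFinP; exact: measurable_indic.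
  rewrite big_enum/= (eq_bigr (fun=> b%:E)) => [|c _].
    by rewrite sumEFin sumr_const mulr_natl.
  rewrite (integral_indic _ (measurableT : measurable [set: X]) (mP c)) setIT; exact: muP.
have mS n : measurable_fun setT (iter (k ^ n) T) by exact: (mpTn _).1.
pose g : X -> \bar R := weighted_maximal w (fun n => iter (k ^ n) T) f.
have mg : measurable_fun setT g by exact: measurable_weighted_maximal.
pose U := [set x | (y%:E <= `|g x|)%E].
have mU : measurable U.
  rewrite -[U]setTI; apply: emeasurable_fun_c_infty => //.
  exact: measurableT_comp.
have ZU : \bigcup_(c in [set` enum Z]) P c `<=` U.
  move=> x [c /=]; rewrite mem_enum => /ZE[t [A [AE yA]]] Pcx.
  rewrite /U /=; apply: le_trans (lee_abs _).
  apply: le_trans (ereal_sup_ubound _) => /=; last by exists t.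
  rewrite lee_fin -mulrA mulrCA ler_pdivlMl ?exprn_gt0// mulrC.
  apply: le_trans yA _; rewrite ler_pM2l//.
  apply: card_le_sum_nat => // n /AE[nt cn ncE]; split=> //.
  rewrite /f (bigD1_seq (decr n c)) ?mem_enum ?enum_uniq//=.
  rewrite -[leLHS]addr0 lerD//; last by apply: sumr_ge0 => ? _; rewrite indicE.
  rewrite indicE mem_set// /P/= -iterD.
  by move: Pcx; rewrite /P/= [in X in X -> _]/digits_value (wsum_decr _ cn).
have : (y%:E * mu U <= C%:E * (#|E|%:R * b)%:E)%E.
  rewrite -normf; apply: le_trans (weak f intf).
  by apply: ereal_sup_ubound; exists y.
have : (y%:E * (#|Z|%:R * b)%:E <= y%:E * mu U)%E.
  rewrite lee_pmul2l// -(measure_disjoint_union Z mP muP disjP).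
  apply: le_measure; rewrite ?inE//.
  by apply: fin_bigcup_measurable => // c _.
move=> /le_trans /[apply].
by rewrite -!EFinM lee_fin !mulrA ler_pM2r.
Qed.

(** Summing the counting inequality over all level sets E v replaces the
    average over v: the E v partition the digit vectors, and the X v cover them
    at least |I|/2 times. *)
Lemma card_blocks_le d (X : measurableType d) (R : realType)
    (mu : probability X R) (T : X -> X) (k M : nat) (w : nat -> R) (C y : R)
    (I : finType) (B : I -> {set 'I_M}) (tau : I -> nat) :
  (1 < k)%N ->
  countably_separated mu -> measure_preserving mu T -> aperiodic mu T ->
  weak_type_bound mu w (fun n => iter (k ^ n) T) C ->
  (forall t, 0 < w t) -> 0 < y ->
  (forall i j n, n \in B i -> n \in B j -> i = j) ->
  (forall i n, n \in B i -> (0 < n <= 2 ^ tau i)%N) ->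
  (forall i, 2 * y * 2 ^+ tau i <= w (tau i) * #|B i|%:R) ->
  y * #|I|%:R <= 2 * C.
Proof.
move=> k1 sep mpT apT weak w0 y0 disjB Btau By.
have [V [E [Z [sumE sumZ ZE]]]] := level_sets_of_block_sum k1 disjB.
have [A [mA A0 disjA]] := aperiodic_tower_base (k ^ M) sep mpT apT.
have level v : y * #|Z v|%:R <= C * #|E v|%:R.
  apply: (tower_transference mpT weak w0 mA A0 disjA y0) => c /ZE[i half].
  exists (tau i), [set n in B i | (0 < c n)%N && (decr n c \in E v)]%SET.
  split=> [n|]; first by rewrite inE => /and3P[/Btau ? ? ?]; split.
  rewrite -(ler_pM2l (ltr0n R 2)) mulrA (le_trans (By i))//.
  by rewrite mulrCA ler_pM2l// -natrM ler_nat.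
set D := #|{ffun 'I_M -> 'I_k}| in sumE sumZ.
have D0 : 0 < D%:R :> R.
  by rewrite ltr0n /D card_ffun card_ord expn_gt0 (ltnW k1).
have yZ : y * (\sum_v #|Z v|)%:R <= C * D%:R.
  by rewrite -sumE !natr_sum !mulr_sumr; apply: ler_sum => v _.
rewrite -(ler_pM2r D0) -mulrA -natrM.
apply: (@le_trans _ _ (y * (2 * \sum_v #|Z v|)%:R)); first by rewrite ler_pM2l// ler_nat.
by rewrite natrM mulrCA -mulrA ler_pM2l.
Qed.

(** * Many blocks at many scales *)

(** The length s is chosen just above r = 2^t y / (4 w), so that half a block
    of hits gives averages of size y / 8.  As w > y, r is below 2^(t-2); hence
    s is at most 2^(t-2), half of the available 2^(t-1) exponents, and rounding
    the number J of blocks down loses at most a factor 2. *)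
Lemma block_size_and_number (R : realType) (w y : R) (t : nat) :
  (2 <= t)%N -> 0 < y -> y < w -> w < 2 ^+ t * y ->
  exists s J : nat, [/\ (J * s <= 2 ^ t.-1)%N, 2 ^+ t * y <= 4 * w * s%:R &
    w <= 5 * y * J%:R].
Proof.
case: t => [|[|t]]// _ y0 yw wty.
have w0 : 0 < w := lt_trans y0 yw.
have r4 : 2 ^+ t.+2 = 4 * 2 ^+ t :> R by rewrite !exprS mulrA; congr (_ * _); ring.
rewrite {}r4 in wty *.
pose r := 2 ^+ t * y / w.
have rw : r * w = 2 ^+ t * y by rewrite /r divfK// gt_eqF.
pose s := (Num.truncn r).+1.
have r0 : 0 <= r by rewrite divr_ge0 ?mulr_ge0 ?exprn_ge0// ltW.
have /andP[sr rs] := truncn_itv r0.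
have rt : r < 2 ^+ t by rewrite /r ltr_pdivrMr// ltr_pM2l// exprn_gt0.
have st : (s <= 2 ^ t)%N by rewrite /s -(ltr_nat R) natrX (le_lt_trans sr).
have s1 : s%:R <= r + 1 by rewrite /s -natr1 lerD2r.
exists s, (2 ^ t.+1 %/ s)%N; split; first exact: leq_divM.
- by rewrite -!mulrA ler_pM2l// -rw [leLHS]mulrC ler_pM2l// ltW.
set J := (2 ^ t.+1 %/ s)%N.
have Js : (2 ^ t <= J * s)%N.
  have := divn_eq (2 ^ t.+1) s; have := @ltn_pmod (2 ^ t.+1) s isT.
  rewrite -/J [in X in X = _ -> _]expnS; lia.
have {Js} : 2 ^+ t <= J%:R * s%:R :> R by rewrite -natrM -natrX ler_nat.
have q : s%:R * w <= 5 * 2 ^+ t * y.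
  have : s%:R * w <= (r + 1) * w by rewrite ler_pM2r.
  rewrite mulrDl rw mul1r; move: wty; lra.
have J0 : 0 <= J%:R :> R by [].
have t0 : 0 < 2 ^+ t :> R by rewrite exprn_gt0.
move=> Js; rewrite -(ler_pM2l t0).
apply: (@le_trans _ _ (J%:R * s%:R * w)); first by rewrite ler_pM2r.
rewrite -mulrA; apply: (@le_trans _ _ (J%:R * (5 * 2 ^+ t * y))).
  by rewrite ler_wpM2l.
by rewrite [leLHS](_ : _ = 2 ^+ t * (5 * y * J%:R))//; ring.
Qed.

Lemma card_ord_interval (M a s : nat) :
  (a + s < M)%N -> (s <= #|[set n : 'I_M | (a < n <= a + s)%N]%SET|)%N.
Proof.
case: M => [//|M] asM.
pose f (i : 'I_s) : 'I_M.+1 := inord (a + i.+1).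
have fE (i : 'I_s) : f i = (a + i.+1)%N :> nat.
  by rewrite /f inordK// (leq_ltn_trans _ asM)// leq_add2l.
have finj : injective f.
  by move=> i j /(congr1 val)/=; rewrite !fE => /addnI[] /val_inj.
rewrite -[X in (X <= _)%N](card_ord s) -(card_imset _ finj).
apply/subset_leq_card/fintype.subsetP => _ /imsetP[i _ ->].
by rewrite inE fE leq_add2l ltn_ord addnS ltnS leq_addr.
Qed.

(** The constant is 80 = 5 * 8 * 2: a scale t that counts gives at least
    w_t / (5 y) blocks, blocks are tested at height y / 8, and only half of the
    levels are good for a given block.  The sum starts at t = 2 because the
    bound 2^(t-2) on the length of a block is used. *)
Lemma partial_C1_le d (X : measurableType d) (R : realType)
    (mu : probability X R) (T : X -> X) (k N : nat) (w : nat -> R) (C y : R) :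
  (1 < k)%N ->
  countably_separated mu -> measure_preserving mu T -> aperiodic mu T ->
  weak_type_bound mu w (fun n => iter (k ^ n) T) C ->
  (forall t, 0 < w t) -> 0 < y ->
  \sum_(2 <= t < N) (if y < w t < 2 ^+ t * y then w t else 0) <= 80 * C.
Proof.
move=> k1 sep mpT apT weak w0 y0.
(* Length and number of the blocks at scale t; with no blocks where the summand
   vanishes, every block that exists is long enough. *)
have params t : exists sJ : nat * nat,
    [/\ (sJ.2 * sJ.1 <= 2 ^ t.-1)%N,
        (0 < sJ.2)%N -> (2 <= t)%N /\ 2 ^+ t * y <= 4 * w t * sJ.1%:R &
        (2 <= t)%N -> (if y < w t < 2 ^+ t * y then w t else 0) <= 5 * y * sJ.2%:R].
  have [t2|t2] := ltnP 1 t; last by exists (0, 0)%N.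
  case: ifP => [/andP[yw wy]|_]; last first.
    by exists (0, 0)%N; split => // _; rewrite mulr0.
  by have [s [J [? ? ?]]] := block_size_and_number t2 y0 yw wy; exists (s, J).
have [sJ sJP] := choice params.
pose s t := (sJ t).1; pose J t := (sJ t).2.
pose I : finType := {t : 'I_N & 'I_(J t)}.
pose start (i : I) := (2 ^ (tag i : 'I_N).-1 + tagged i * s (tag i))%N.
(* Block i is the interval of length s t starting after start i, inside
   (2^(t-1), 2^t]. *)
pose B (i : I) : {set 'I_(2 ^ N).+1} :=
  [set n : 'I_(2 ^ N).+1 | (start i < n <= start i + s (tag i))%N]%SET.
have J0 (i : I) : (0 < J (tag i))%N by rewrite (leq_trans _ (ltn_ord (tagged i))).
have t2 (i : I) : (2 <= (tag i : 'I_N))%N by have [_ /(_ (J0 i))[]] := sJP (tag i).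
have last_le (i : I) : (start i + s (tag i) <= 2 ^ (tag i : 'I_N))%N.
  have [le_Js _ _] := sJP (tag i).
  have -> : (2 ^ (tag i : 'I_N) = 2 ^ (tag i : 'I_N).-1 + 2 ^ (tag i : 'I_N).-1)%N.
    by rewrite addnn -mul2n -expnS prednK// (leq_trans _ (t2 i)).
  rewrite /start -addnA leq_add2l -mulSnr (leq_trans _ le_Js)//.
  by rewrite leq_mul2r (ltn_ord (tagged i)) orbT.
have disjB i j n : n \in B i -> n \in B j -> i = j.
  (* A common exponent lies in only one dyadic range. *)
  have scale (i1 i2 : I) : n \in B i1 -> n \in B i2 ->
      ((tag i1 : nat) <= (tag i2 : nat))%N.
    rewrite !inE => /andP[n1 _] /andP[_ n2]; rewrite leqNgt; apply/negP => lt21.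
    have : (2 ^ (tag i1 : 'I_N).-1 < 2 ^ (tag i2 : 'I_N))%N.
      rewrite (leq_ltn_trans _ (leq_trans n1 (leq_trans n2 (last_le i2))))//.
      by rewrite /start leq_addr.
    by rewrite ltn_exp2l// ltnNge -ltnS prednK ?lt21// (leq_trans _ (t2 i1)).
  move=> ni nj.
  have eqt : tag i = tag j by apply/val_inj/eqP; rewrite eqn_leq !scale.
  case: i j ni nj eqt => [t a] [t' b] ni nj /= eqt; subst t'.
  suff -> : a = b by [].
  have le_of_lt x z : (2 ^ t.-1 + x * s t < n)%N ->
      (n <= 2 ^ t.-1 + z * s t + s t)%N -> (x <= z)%N.
    move=> nx /(leq_trans nx).
    by rewrite -addnA ltn_add2l -mulSnr ltn_mul2r ltnS => /andP[].
  move: ni nj; rewrite !inE /start /= => /andP[a1 a2] /andP[b1 b2].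
  by apply/val_inj/eqP; rewrite eqn_leq (le_of_lt _ _ a1 b2) (le_of_lt _ _ b1 a2).
have Btau i n : n \in B i -> (0 < n <= 2 ^ (tag i : 'I_N))%N.
  rewrite inE => /andP[n0 n1]; rewrite (leq_ltn_trans _ n0)//.
  exact: leq_trans n1 (last_le i).
have By i : 2 * (y / 8) * 2 ^+ (tag i : 'I_N) <= w (tag i) * #|B i|%:R.
  have [_ /(_ (J0 i))[_ sy] _] := sJP (tag i).
  have : w (tag i) * (s (tag i))%:R <= w (tag i) * #|B i|%:R.
    rewrite ler_pM2l// ler_nat card_ord_interval// ltnS (leq_trans (last_le i))//.
    by rewrite leq_exp2l// ltnW.
  by apply: le_trans; rewrite /s; lra.
have y8 : 0 < y / 8 by rewrite divr_gt0.
have := card_blocks_le k1 sep mpT apT weak w0 y8 disjB Btau By.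
have cardI : #|I|%:R = \sum_(t < N) (J t)%:R :> R.
  rewrite card_tagged sumnE big_map big_enum/= natr_sum.
  by apply: eq_bigr => t _; rewrite card_ord.
have : \sum_(2 <= t < N) (if y < w t < 2 ^+ t * y then w t else 0)
    <= 5 * y * #|I|%:R.
  rewrite cardI mulr_sumr -(big_mkord xpredT (fun t => 5 * y * (J t)%:R)).
  have pos t : 0 <= 5 * y * (J t)%:R by rewrite !mulr_ge0// ltW.
  apply: (@le_trans _ _ (\sum_(2 <= t < N) 5 * y * (J t)%:R)).
    rewrite big_nat_cond [leRHS]big_nat_cond.
    by apply: ler_sum => t /andP[/andP[t2' _] _]; have [_ _] := sJP t; exact.
  have [N2|N2] := ltnP N 2; last by rewrite [leRHS](big_cat_nat _ N2)//= lerDr sumr_ge0.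
  rewrite (big_geq (ltnW N2)); exact: sumr_ge0.
move=> + +; lra.
Qed.

(** The two scales outside [partial_C1_le] contribute at most w_0 + w_1, a
    bound uniform in y. *)
Lemma power_iterates_bad d (X : measurableType d) (R : realType)
    (mu : probability X R) (T : X -> X) (k : nat) :
  (1 < k)%N ->
  countably_separated mu -> measure_preserving mu T -> aperiodic mu T ->
  bad_along mu (fun n => iter (k ^ n) T).
Proof.
move=> k1 sep mpT apT w w0 C1w [C [C0 weak]].
suff : (C1 w <= (w 0%N + w 1%N + 80 * C)%:E)%E by rewrite C1w leye_eq.
apply: ge_ereal_sup => _ [y /= y0 <-].
have term0 t : (0 <= (if (y < w t < 2 ^+ t * y) then w t else 0))%R.
  by case: ifP => // _; exact: ltW.
apply: lime_le; first by apply: is_cvg_nneseries => t _ _; rewrite lee_fin.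
apply: nearW => N; rewrite sumEFin lee_fin.
have le_term t : (if (y < w t < 2 ^+ t * y) then w t else 0) <= w t.
  by case: ifP => // _; exact: ltW.
have := partial_C1_le N k1 sep mpT apT weak w0 y0.
case: N => [|[|N]].
- by rewrite !big_geq// => _; rewrite !addr_ge0 ?mulr_ge0// ltW.
- rewrite big_geq// big_nat1 => C80; have := le_term 0%N; have := w0 1%N; lra.
- move=> C80; rewrite big_ltn// big_ltn// addrA.
  by rewrite !lerD.
Qed.

Theorem theorem6p1 (R : realType) (k : int) (hk : 2 <= k) :
  ultimately_bad_int R (fun n : nat => k ^+ n) /\
  ultimately_bad_real (fun n : nat => (k%:~R : R) ^+ n).
Proof.
case: k hk => [k|//]; rewrite lez_nat => k1.
split=> d X mu T sep.
  move=> mpT _ apT.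
  suff -> : (fun n => int_iter T (Posz k ^+ n)) = (fun n => iter (k ^ n) T).
    exact: power_iterates_bad.
  have PoszX n : Posz k ^+ n = Posz (k ^ n) by rewrite -!natz natrX.
  by apply/funext => n; rewrite PoszX.
move=> [mpT T0 TD] apT.
have iterT m : iter m (T 1) = T m%:R.
  elim: m => [|m IH]; first by rewrite T0.
  by rewrite -natr1 addrC TD -IH.
suff -> : (fun n => T ((Posz k)%:~R ^+ n)) = (fun n => iter (k ^ n) (T 1)).
  apply: power_iterates_bad => //.
  apply: negligibleS apT => x [n [n1 fix_x]]; exists n%:R.
  by split; [rewrite pnatr_eq0 -lt0n|rewrite -iterT].
by apply/funext => n; rewrite iterT natrX.
Qed.
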